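(* Consider the system $$x_{n+1}=f_0(u_n)+f_1(u_n)\,x_n,\qquad u_{n+1}=\phi(u_n),$$ where $f_0,f_1,\phi\in\mathcal{C}^1(\mathcal{U})$, $\mathcal{U}$ is a neighborhood of $u=u_*$, and $|f_1(u_* )|=1$. Suppose that $u=u_*$ is a hyperbolic attractor of $\phi$. Then, for any $u_0$ in the basin of attraction of $u=u_*$ (and any initial condition $(x_0,u_0)$ with this $u_0$), there exists $\ell(x_0,u_0)\in\mathbb{R}$ such that: (a) If $f_0(u_* )=0$ and $f_1(u_* )=1$, then $\lim_{n\to\infty}(x_n,u_n)=(\ell(x_0,u_0),u_* )$. (b) If $f_1(u_* )=-1$, then $\lim_{n\to\infty}(x_{2n},u_{2n})=(\ell(x_0,u_0),u_* )$ and $\lim_{n\to\infty}(x_{2n+1},u_{2n+1})=(f_0(u_* )-\ell(x_0,u_0),u_* )$. Furthermore, for any point $(x_*,u_* )\in\{u=u_*\}$ there exists an initial condition $(x_0,u_0)$ in the basin of attraction of the limit fiber $\{u=u_*\}$ such that $\lim_{n\to\infty}(x_n,u_n)=(x_*,u_* )$.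
   Context: Here $\{x_n\}$ and $\{u_n\}$ are real sequences and $f_0,f_1,\phi$ are continuous real functions of one real variable. A hyperbolic attractor $u_*$ of $\phi$ is a fixed point of $\phi$ with $|\phi'(u_* )|<1$. The basin of attraction of $u_*$ is the set of $u_0$ whose orbit under $u_{n+1}=\phi(u_n)$ converges to $u_*$. The limit fiber is the line $\{u=u_*\}$ in the $(x,u)$-plane, and a point $(x_0,u_0)$ is in its basin of attraction if $u_0$ is in the basin of attraction of $u_*$.
   Formalization: The ''Furthermore'' claim fails as written (e.g. f_0=0, f_1=-1, φ=u/2, x_*=1); it is stated for the full sequence in case (a), and in case (b) only for the even-indexed subsequence (x_{2n},u_{2n}); it is not claimed when f_1(u_* )=1 and f_0(u_* )≠0. *)

(* Defs.v *)
From HB Require Import structures.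
From mathcomp Require Import all_boot all_order all_algebra.
From mathcomp Require Import all_classical all_reals all_analysis.
Set Implicit Arguments.
Unset Strict Implicit.
Unset Printing Implicit Defensive.
Import Order.TTheory GRing.Theory Num.Theory.
Import numFieldNormedType.Exports.
Local Open Scope classical_set_scope.
Local Open Scope ring_scope.

(* Meant for open U: f^`() is the two-sided derivative on R, and its continuity
   at a point of U is continuity along all of R. *)
Definition C1_on (R : realType) (U : set R) (f : R -> R) : Prop :=
  forall u, U u -> derivable f u 1 /\ {for u, continuous f^`()%classic}.

(* Derivability is required explicitly because f^`() has a default value where
   f is not derivable. *)
Definition hyperbolic_attractor (R : realType) (phi : R -> R) (us : R) : Prop :=
  [/\ phi us = us, derivable phi us 1 & `|phi^`()%classic us| < 1].

Definition forward_orbit (T : Type) (F : T -> T) (p0 : T) : nat -> T :=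
  fun n => iter n F p0.

Definition basin (R : realType) (phi : R -> R) (us : R) : set R :=
  [set u0 | forward_orbit phi u0 @ \oo --> us].

(* Points of the plane are pairs (x, u): the fiber variable x comes first. *)
Definition skew_map (R : realType) (f0 f1 phi : R -> R) (p : R * R) : R * R :=
  (f0 p.2 + f1 p.2 * p.1, phi p.2).

Definition limit_fiber (R : realType) (us : R) : set (R * R) :=
  [set p | p.2 = us].

Definition limit_fiber_basin (R : realType) (phi : R -> R) (us : R) :
    set (R * R) :=
  [set p | basin phi us p.2].

(* Main.v *)
Require Import Defs.
From HB Require Import structures.
From mathcomp Require Import all_boot all_order all_algebra.
From mathcomp Require Import all_classical all_reals all_analysis.
From mathcomp Require Import ring lra.
Set Implicit Arguments.
Unset Strict Implicit.
Unset Printing Implicit Defensive.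
Import Order.TTheory GRing.Theory Num.Theory.
Import numFieldNormedType.Exports.
Local Open Scope classical_set_scope.
Local Open Scope ring_scope.

(** The multiplier of the fiber map tends to [f1 us = s] with [s ^+ 2 = 1], so
    the limiting fiber map [x |-> f0 us + s * x] is the identity in the first
    case and the reflection about [f0 us / 2] in the second. In both cases it
    is [x |-> c + s * (x - c)] for a fixed point [c]. In the rotating
    coordinate [y n = s ^+ n * (x n - c)] the limiting dynamics is trivial, and
    the true dynamics moves [y] by at most [e n * (1 + `|y n|)], where
      [e n = `|f0 (u n) - f0 us| + (1 + `|c|) * `|f1 (u n) - f1 us|].
    Hyperbolicity makes [`|u n - us|] decay geometrically, and a function
    derivable at [us] is Lipschitz at that point, so [e] is summable
    ([orbit_observable_summable]). A sequence whose increments are bounded in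
    that way converges ([summable_perturbation_cvg]): a discrete Gronwall
    estimate bounds it, after which its increments are absolutely summable.
    Since [x n = c + s ^+ n * y n], the limit [b] of [y] gives
    [x n --> c + b] when [s = 1], and the limits [c + b] and [c - b] along even
    and odd times when [s = -1] ([fiber_coordinate_cvg]).

    Surjectivity onto the limit fiber needs no asymptotics: the fiber is
    invariant, it consists of fixed points in the first case, and of
    points of period two in the second. *)

(** * Sequences *)

(** The hypothesis makes [series a + v] eventually nonincreasing, and both terms
    are bounded below. With [v] a multiple of [a], this is the ratio test. *)
Lemma series_telescope_cvg (R : realType) (a v : R ^nat) :
  (forall n, 0 <= a n) -> cvgn v ->
  (\forall n \near \oo, a n <= v n - v n.+1) -> cvgn (series a).
Proof.
move=> a_ge0 v_cvg [N _ aN].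
suff sv_cvg : cvgn (series a + v).
  by rewrite -[series a](addrK v); apply: is_cvgB.
apply: (@near_nonincreasing_is_cvgn _ _ (limn v - 1)).
- exists N => //= n Nn m.
  elim: m => [|m IH]; first by rewrite leqn0 => /eqP->.
  rewrite leq_eqVlt => /predU1P[->//|]; rewrite ltnS => nm.
  apply: le_trans (IH nm); have := aN m (leq_trans Nn nm).
  by rewrite /= !addrfctE seriesSr; lra.
- have : \forall n \near \oo, limn v - 1 < v n.
    by apply: (cvgr_gt (limn v)) => //; rewrite ltrBlDr ltrDl.
  apply: filterS => n vn; rewrite addrfctE -[leLHS]add0r lerD ?(ltW vn) //.
  by rewrite /series /= sumr_ge0.
Qed.

(** Boundedness is the discrete Gronwall inequality: [1 + `|y n|] is multiplied
    at each step by at most [1 + e n <= expR (e n)]. *)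
Lemma summable_perturbation_cvg (R : realType) (e y : R ^nat) :
  (forall n, 0 <= e n) -> cvgn (series e) ->
  (forall n, `|y n.+1 - y n| <= e n * (1 + `|y n|)) -> cvgn y.
Proof.
move=> e_ge0 e_cvg dy.
have e_nd : nondecreasing_seq (series e).
  by apply/nondecreasing_seqP => n; rewrite seriesSr lerDl.
have gronwall n : 1 + `|y n| <= (1 + `|y 0%N|) * expR (series e n).
  elim: n => [|n IH]; first by rewrite /series /= big_geq // expR0 mulr1.
  rewrite seriesSr expRD mulrA.
  apply: (@le_trans _ _ ((1 + `|y n|) * (1 + e n))).
    have := ler_normD (y n.+1 - y n) (y n); rewrite subrK.
    by have := dy n; lra.
  by apply: ler_pM; rewrite ?addr_ge0 ?expR_ge1Dx.
pose M := (1 + `|y 0%N|) * expR (limn (series e)).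
have y_bnd n : 1 + `|y n| <= M.
  apply: le_trans (gronwall n) _; rewrite ler_wpM2l ?addr_ge0 //.
  by rewrite ler_expR nondecreasing_cvgn_le.
suff /(normed_cvg (V := R)) : cvgn [normed series (telescope y)].
  rewrite telescopeK => ty_cvg.
  have -> : y = [sequence y n - y 0%N]_n + cst (y 0%N).
    by apply/funext => n; rewrite addrfctE /= subrK.
  by apply: is_cvgD => //; exact: is_cvg_cst.
apply: (@series_le_cvg _ _ (M *: e)) => [n|n|n|].
- exact: normr_ge0.
- by rewrite mulr_ge0 // (le_trans _ (y_bnd 0%N)) // addr_ge0.
- rewrite /telescope /=; apply: le_trans (dy n) _.
  by rewrite [leRHS]mulrC ler_wpM2l.
- exact: is_cvg_seriesZ.
Qed.

(** * Orbits attracted to a hyperbolic fixed point *)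

Lemma derivable_near_lipschitz (R : realType) (f : R -> R) (a K : R) :
  derivable f a 1 -> `|f^`()%classic a| < K ->
  \forall u \near a, `|f u - f a| <= K * `|u - a|.
Proof.
move=> fa; rewrite derive1E => /cvgr_norm_lt - /(_ _ _ _ _ fa) dq.
rewrite nbhs0P.
have : \forall h \near (0 : R)^', `|f (a + h) - f a| <= K * `|h|.
  have h_neq0 := @nbhs_dnbhs_neq R 0.
  apply: filterS2 dq h_neq0 => h /= qh h0.
  move: qh; rewrite scaler1 [h + a]addrC normrM normfV ltr_pdivrMl ?normr_gt0 //.
  by rewrite [_ * K]mulrC => /ltW.
rewrite /dnbhs near_withinE; apply: filterS => h hP.
rewrite [a + h - a]addrC addKr.
have [->|/hP//] := eqVneq h 0.
by rewrite addr0 subrr !normr0 mulr0.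
Qed.

(** Near [us] the distance to [us] contracts by a factor [q < 1], so it is at
    most [(1 - q)^-1] times its own decrease in one step; observables that are
    Lipschitz at [us] inherit this telescoping bound. *)
Lemma orbit_observable_summable (R : realType) (phi f : R -> R) (us u0 : R) :
  hyperbolic_attractor phi us -> basin phi us u0 -> derivable f us 1 ->
  cvgn (series (fun n => `|f (forward_orbit phi u0 n) - f us|)).
Proof.
move=> [phi_us dphi phi_lt1] u_cvg df.
set u := forward_orbit phi u0.
have [q [phi_q q_lt1]] : exists q, `|phi^`()%classic us| < q /\ q < 1.
  (* [q] is the midpoint between the multiplier and 1 *)
  by exists ((`|phi^`()%classic us| + 1) / 2); split; lra.
have q1_gt0 : 0 < 1 - q by rewrite subr_gt0.
pose L := `|f^`()%classic us| + 1.
have L_gt0 : 0 < L by rewrite ltr_wpDl.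
have fL : `|f^`()%classic us| < L by rewrite ltrDl.
have w_cvg : `|u n - us| @[n --> \oo] --> (0 : R).
  have /cvg_norm : u n - us @[n --> \oo] --> us - us.
    by apply: cvgB => //; exact: cvg_cst.
  by rewrite subrr normr0.
apply: (@series_telescope_cvg _ _ (fun n => L / (1 - q) * `|u n - us|)) => [n||].
- exact: normr_ge0.
- by apply: is_cvgM; [exact: is_cvg_cst|apply/cvg_ex; exists 0].
have phi_near : \forall n \near \oo,
    `|phi (u n) - phi us| <= q * `|u n - us|.
  exact: u_cvg (derivable_near_lipschitz dphi phi_q).
have f_near : \forall n \near \oo, `|f (u n) - f us| <= L * `|u n - us|.
  exact: u_cvg (derivable_near_lipschitz df fL).
apply: filterS2 phi_near f_near => n; rewrite phi_us => phi_un f_un.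
apply: le_trans f_un _.
rewrite -mulrBr -mulrA ler_pM2l // ler_pdivlMl //.
by rewrite /u /forward_orbit /= -/(forward_orbit phi u0 n) -/u; lra.
Qed.

(** * The skew product *)

Section SkewProduct.
Variables (R : realType) (f0 f1 phi : R -> R).
Local Notation F := (skew_map f0 f1 phi).

Lemma skew_orbit_snd (p : R * R) n :
  (forward_orbit F p n).2 = forward_orbit phi p.2 n.
Proof. by rewrite /forward_orbit; elim: n => //= n ->. Qed.

(** The recurrence for [y n = s ^+ n * (x n - c)] uses [s ^+ 2 = 1] and that
    [c] is fixed by the limiting fiber map:
    [y n.+1 - y n = s ^+ n.+1 * (da + db * c) + s * db * y n], with [da] and
    [db] the deviations of [f0] and [f1] from their values at [us]. *)
Lemma fiber_coordinate_cvg (us c : R) (p : R * R) :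
  hyperbolic_attractor phi us -> basin phi us p.2 ->
  derivable f0 us 1 -> derivable f1 us 1 ->
  `|f1 us| = 1 -> f0 us + f1 us * c = c ->
  cvgn (fun n => f1 us ^+ n * ((forward_orbit F p n).1 - c)).
Proof.
move=> attr p_basin df0 df1 s_norm c_fix.
set s := f1 us; set x := fun n => (forward_orbit F p n).1.
set u := forward_orbit phi p.2.
have xS n : x n.+1 = f0 (u n) + f1 (u n) * x n by rewrite /u -skew_orbit_snd.
have ss : s * s = 1 by rewrite -expr2 -real_normK ?num_real // s_norm expr1n.
have sX n : `|s ^+ n| = 1 by rewrite normrX s_norm expr1n.
pose a n : R := `|f0 (u n) - f0 us|; pose b n : R := `|f1 (u n) - f1 us|.
apply: (@summable_perturbation_cvg _ (a + (1 + `|c|) *: b)).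
- move=> n; apply: addr_ge0; first exact: normr_ge0.
  by apply: mulr_ge0; [exact: addr_ge0|exact: normr_ge0].
- apply: is_cvg_seriesD; last apply: is_cvg_seriesZ.
    exact: orbit_observable_summable attr p_basin df0.
  exact: orbit_observable_summable attr p_basin df1.
move=> n; rewrite addrfctE /=.
set y := s ^+ n * (x n - c).
(* [f0 us] is eliminated through [c_fix]; the rest is algebra modulo [ss] *)
have -> : s ^+ n.+1 * (x n.+1 - c) - y =
    s ^+ n.+1 * ((f0 (u n) - f0 us) + (f1 (u n) - f1 us) * c)
      + s * (f1 (u n) - f1 us) * y.
  have -> : f0 us = c - s * c by rewrite -{1}c_fix addrK.
  rewrite xS exprS /y -/s.
  have -> : s ^+ n * (x n - c) = s * s * (s ^+ n * (x n - c)) by rewrite ss mul1r.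
  set S := s ^+ n; set A := f0 _; set B := f1 _.
  have s3 : s * (s * s) = s by rewrite ss mulr1.
  by ring: ss s3.
clearbody y; apply: le_trans (ler_normD _ _) _; rewrite !normrM sX s_norm !mul1r.
have := ler_normD (f0 (u n) - f0 us) ((f1 (u n) - f1 us) * c).
rewrite normrM -/(a n) -/(b n) => tri.
have [a0 b0] : 0 <= a n /\ 0 <= b n by split; exact: normr_ge0.
have := normr_ge0 c; have := normr_ge0 y => y0 c0.
rewrite -[((1 + `|c|) *: b) n]/((1 + `|c|) * b n).
apply: le_trans (lerD tri (lexx _)) _.
have := mulr_ge0 a0 y0; have := mulr_ge0 (mulr_ge0 b0 c0) y0.
by lra.
Qed.

Lemma skew_orbit_cvg (us u0 x0 l : R) (k : nat -> nat) :
  basin phi us u0 -> k @ \oo --> \oo ->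
  (forward_orbit F (x0, u0) (k n)).1 @[n --> \oo] --> l ->
  forward_orbit F (x0, u0) (k n) @[n --> \oo] --> (l, us).
Proof.
move=> u0_basin k_cvg x_cvg.
under eq_cvg do rewrite [forward_orbit F _ _]surjective_pairing skew_orbit_snd.
exact: (cvg_pair x_cvg (cvg_comp _ _ k_cvg u0_basin)).
Qed.

End SkewProduct.

Theorem corollary8 (R : realType) (f0 f1 phi : R -> R) (us : R) (U : set R)
  (f0_cont : continuous f0) (f1_cont : continuous f1)
  (phi_cont : continuous phi)
  (U_open : open U) (U_us : U us)
  (f0_C1 : C1_on U f0) (f1_C1 : C1_on U f1) (phi_C1 : C1_on U phi)
  (f1_us : `|f1 us| = 1)
  (us_attr : hyperbolic_attractor phi us) :
  [/\ forall x0 u0 : R, basin phi us u0 ->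
        exists l : R,
          (f0 us = 0 /\ f1 us = 1 ->
             forward_orbit (skew_map f0 f1 phi) (x0, u0) n @[n --> \oo]
               --> (l, us)) /\
          (f1 us = -1 ->
             forward_orbit (skew_map f0 f1 phi) (x0, u0) (2 * n)%N @[n --> \oo]
               --> (l, us) /\
             forward_orbit (skew_map f0 f1 phi) (x0, u0) (2 * n + 1)%N @[n --> \oo]
               --> (f0 us - l, us)),
      f0 us = 0 /\ f1 us = 1 ->
        forall ps : R * R, limit_fiber us ps ->
          exists p0 : R * R, limit_fiber_basin phi us p0 /\
            forward_orbit (skew_map f0 f1 phi) p0 n @[n --> \oo] --> ps
    & f1 us = -1 ->
        forall ps : R * R, limit_fiber us ps ->
          exists p0 : R * R, limit_fiber_basin phi us p0 /\
            forward_orbit (skew_map f0 f1 phi) p0 (2 * n)%N @[n --> \oo] --> ps].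
Proof.
have [phi_us _ _] := us_attr.
have [df0 _] := f0_C1 us U_us; have [df1 _] := f1_C1 us U_us.
have us_basin : basin phi us us.
  rewrite /basin /= (_ : forward_orbit phi us = cst us); first exact: cvg_cst.
  by apply/funext; elim=> //= n; rewrite /forward_orbit /= => ->.
pose F := skew_map f0 f1 phi.
have coord c x0 u0 : basin phi us u0 -> f0 us + f1 us * c = c ->
    exists b : R, f1 us ^+ n * ((forward_orbit F (x0, u0) n).1 - c)
      @[n --> \oo] --> b.
  move=> u0_basin c_fix; apply/cvg_ex.
  exact: (@fiber_coordinate_cvg _ f0 f1 phi us c (x0, u0)).
split.
- move=> x0 u0 u0_basin.
  have [[f0_0 f1_1]|not_id] := pselect (f0 us = 0 /\ f1 us = 1).
    have [|b] := coord 0 x0 u0 u0_basin; first by rewrite f0_0 mulr0 addr0.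
    rewrite f1_1; under eq_cvg do rewrite expr1n mul1r subr0.
    move=> x_cvg; exists b; split=> [_|?]; last by exfalso; lra.
    exact: (skew_orbit_cvg (k := id)).
  have [f1_N1|f1_1] := eqVneq (f1 us) (-1); last first.
    (* neither case applies, so any value serves *)
    by exists 0; split=> // /eqP; rewrite (negbTE f1_1).
  (* the centre of the reflection [x |-> f0 us - x] *)
  pose c := f0 us / 2.
  have [|b] := coord c x0 u0 u0_basin; first by rewrite f1_N1 /c; lra.
  move=> y_cvg; rewrite f1_N1 in y_cvg.
  have even_cvg : (fun n => 2 * n)%N @ \oo --> \oo by exact: cvg_mulnl.
  have odd_cvg : (fun n => 2 * n + 1)%N @ \oo --> \oo.
    exact: (cvg_comp _ _ even_cvg (cvg_addnr 1)).
  exists (c + b); split=> [/not_id[]|_]; split.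
    apply: (skew_orbit_cvg u0_basin even_cvg).
    have := cvgD (cvg_cst c) (cvg_comp _ _ even_cvg y_cvg).
    under eq_cvg do
      rewrite addrfctE /= exprM sqrrN !expr1n mul1r addrC subrK.
    by apply.
  have -> : f0 us - (c + b) = c - b by rewrite /c; lra.
  apply: (skew_orbit_cvg u0_basin odd_cvg).
  have := cvgB (cvg_cst c) (cvg_comp _ _ odd_cvg y_cvg).
  under eq_cvg do
    rewrite addrfctE opprfctE /= exprD exprM sqrrN !expr1n mul1r expr1
      mulN1r opprK addrC subrK.
  by apply.
- move=> [f0_0 f1_1] ps ps_us; exists ps.
  split; first by rewrite /limit_fiber_basin /= ps_us.
  rewrite (_ : forward_orbit _ _ = cst ps); first exact: cvg_cst.
  apply/funext; elim=> //= n; rewrite /forward_orbit /= => ->.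
  rewrite /skew_map ps_us f0_0 f1_1 phi_us add0r mul1r.
  by rewrite [RHS]surjective_pairing ps_us.
- move=> f1_N1 ps ps_us; exists ps.
  split; first by rewrite /limit_fiber_basin /= ps_us.
  rewrite (_ : (fun n => _) = cst ps); first exact: cvg_cst.
  apply/funext; elim=> [//|n]; rewrite mulnS /forward_orbit iterD => -> /=.
  rewrite [RHS]surjective_pairing /skew_map /= ps_us !phi_us f1_N1.
  by congr (_, _); ring.
Qed.
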